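(* Let $E\subset\mathbb{R}^n$ have a smooth boundary. Let $x\in\partial E$ and assume that there exist $R_0>0$ and $\beta\in[0,n+1)$ such that for all $R\ge R_0$ $$\mathcal{H}^{n-1}\big(\partial E\cap B_R(x)\big)\le CR^\beta,$$ for some $C>0$ (independent of $R$). Then Simons' identity $$\Delta h=\operatorname{Hess}H+H\,h^2-c^2\,h$$ holds at $x$ on the hypersurface $\partial E$.
   Context: $\mathcal{H}^{n-1}$ is the $(n-1)$-dimensional Hausdorff measure and $B_R(x)$ the ball of radius $R$ centred at $x$. On the smooth hypersurface $\partial E\subset\mathbb{R}^n$ with induced metric $g$ and (local) unit normal (the exterior unit normal $\nu_E$): $h$ is the second fundamental form, with sign such that where $E$ is locally the subgraph of $f$, in the coordinates $y'\mapsto(y',f(y'))$, $h_{ij}=-\partial_{ij}f/\sqrt{1+|\nabla f|^2}$; $H=\sum_{i,j=1}^{n-1}g^{ij}h_{ij}$ is the mean curvature (trace of $h$, no division by $n-1$); $h^2$ is the symmetric 2-tensor $(h^2)_{ij}=\sum_{k,\ell=1}^{n-1}g^{k\ell}h_{ik}h_{\ell j}$; $c^2=\sum_{k,\ell=1}^{n-1}g^{k\ell}(h^2)_{k\ell}$ is the squared norm of the second fundamental form; $\operatorname{Hess}H=(\nabla_i\nabla_jH)_{ij}$ is the covariant Hessian of $H$; and $\Delta h$ is the (connection) Laplacian of the tensor $h$, $(\Delta h)_{ij}=\sum_{\alpha,\beta=1}^{n-1}g^{\alpha\beta}\nabla_\beta\nabla_\alpha h_{ij}$, with $\nabla$ the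 Levi-Civita connection of $g$. *)

(* Defs.v *)
From HB Require Import structures.
From mathcomp Require Import all_boot all_order all_algebra.
From mathcomp Require Import all_classical all_reals all_analysis.

Set Implicit Arguments.
Unset Strict Implicit.
Unset Printing Implicit Defensive.

Import Order.TTheory GRing.Theory Num.Theory.
Import numFieldNormedType.Exports.

Local Open Scope classical_set_scope.
Local Open Scope ring_scope.

(* The library norm on ['rV[R]_n] is the sup norm.  It induces the Euclidean
   topology, so [open], [closure], [nbhs] and the derivatives below need no
   change, but lengths, balls and diameters must use [enorm]. *)
Section Euclidean.
Context {R : realType} {n : nat}.
Implicit Types (u v x : 'rV[R]_n) (A : set 'rV[R]_n).

Definition dotv u v : R := \sum_(a < n) u 0 a * v 0 a.

Definition enorm u : R := Num.sqrt (dotv u u).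

Definition eball x (r : R) : set 'rV[R]_n := [set y | enorm (y - x) < r].

Definition ediam A : \bar R :=
  ereal_sup [set (enorm (z.1 - z.2))%:E | z in A `*` A].

Definition boundary A : set 'rV[R]_n := closure A `\` interior A.

End Euclidean.

(* Volume of the unit ball of R^k: w_0 = 1, w_1 = 2, w_k = (2 pi / k) w_(k-2). *)
Fixpoint unit_ball_volume (R : realType) (k : nat) : R :=
  match k with
  | 0 => 1
  | 1 => 2
  | k'.+2 => 2 * pi / k%:R * unit_ball_volume R k'
  end.

Section Hausdorff.
Context {R : realType} {n : nat}.
Implicit Types (A F : set 'rV[R]_n).

(* The empty set is singled out because of the case k = 0, where 0 ^+ 0 = 1. *)
Definition hausdorff_weight (k : nat) F : \bar R :=
  if F == set0 then 0%E
  else (unit_ball_volume R k * (fine (ediam F) / 2) ^+ k)%:E.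

Definition hausdorff_pre (k : nat) (delta : R) A : \bar R :=
  ereal_inf [set s : \bar R | exists F : nat -> set 'rV[R]_n,
    [/\ A `<=` \bigcup_i F i,
        (forall i, (ediam (F i) <= delta%:E)%E) &
        s = (\sum_(0 <= i <oo) hausdorff_weight k (F i))%E]].

(* The limit as delta tends to 0+ is a supremum, since [hausdorff_pre] is
   nonincreasing in delta. *)
Definition hausdorff_measure (k : nat) A : \bar R :=
  ereal_sup [set hausdorff_pre k delta A | delta in [set d : R | 0 < d]].

End Hausdorff.

Section Smoothness.
Context {R : realType} {m : nat}.
Implicit Types (f : 'rV[R]_m -> R) (U : set 'rV[R]_m).

Definition pd (i : 'I_m) f : 'rV[R]_m -> R :=
  fun u => 'D_(delta_mx 0 i : 'rV[R]_m) f u.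

Fixpoint pds (s : seq 'I_m) f : 'rV[R]_m -> R :=
  if s is i :: s' then pd i (pds s' f) else f.

(* C^oo on the open set U: partial derivatives of every order exist and are
   continuous. *)
Definition smooth_on U f : Prop :=
  forall (s : seq 'I_m) u, U u ->
    {for u, continuous (pds s f)} /\
    (forall i, derivable (pds s f) u (delta_mx 0 i : 'rV[R]_m)).

Definition coord_fun {p : nat} (phi : 'rV[R]_m -> 'rV[R]_p) (a : 'I_p) :
  'rV[R]_m -> R := fun u => phi u 0 a.

Definition smooth_map_on {p : nat} U (phi : 'rV[R]_m -> 'rV[R]_p) : Prop :=
  forall a, smooth_on U (coord_fun phi a).

End Smoothness.

Section Hypersurface.
Context {R : realType} {m : nat}.
Implicit Types (E : set 'rV[R]_m.+1) (U : set 'rV[R]_m).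

Definition horiz (z : 'rV[R]_m.+1) : 'rV[R]_m :=
  \row_i z 0 (widen_ord (leqnSn m) i).

Definition vert (z : 'rV[R]_m.+1) : R := z 0 ord_max.

(* Near each boundary point, in suitable orthonormal coordinates centred there,
   E is the subgraph of a smooth function.  Points of the graph itself may or
   may not belong to E, so that E can be open, closed, or neither. *)
Definition smooth_boundary E : Prop :=
  forall p, boundary E p ->
  exists (Q : 'M[R]_m.+1) (U : set 'rV[R]_m) (f : 'rV[R]_m -> R),
    [/\ Q *m Q^T = 1%:M, open U, U 0, smooth_on U f &
        \forall y \near p, let z := (y - p) *m Q in
          (vert z < f (horiz z) -> E y) /\ (f (horiz z) < vert z -> ~ E y)].

Definition tangent (phi : 'rV[R]_m -> 'rV[R]_m.+1) (i : 'I_m)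
  (u : 'rV[R]_m) : 'rV[R]_m.+1 := \row_a pd i (coord_fun phi a) u.

(* [phi] is a smooth local parametrization of the boundary of E over U, and [N]
   is the exterior unit normal of E along it.  An immersion of an open subset
   of R^m into an m-dimensional hypersurface is a local diffeomorphism onto an
   open part of it, so no injectivity is asked for. *)
Record boundary_chart E U (phi N : 'rV[R]_m -> 'rV[R]_m.+1) : Prop := {
  chart_open : open U;
  chart_smooth : smooth_map_on U phi;
  chart_boundary : forall u, U u -> boundary E (phi u);
  chart_immersion : forall u, U u -> row_free (\matrix_(i < m) tangent phi i u);
  normal_smooth : smooth_map_on U N;
  normal_unit : forall u, U u -> enorm (N u) = 1;
  normal_orthogonal : forall u i, U u -> dotv (tangent phi i u) (N u) = 0;
  normal_exterior : forall u, U u ->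
    \forall t \near (0 : R)^'+, E (phi u - t *: N u) /\ ~ E (phi u + t *: N u)
}.

End Hypersurface.

(* Tensor calculus in coordinates on an open subset of R^m with metric g. *)
Section TensorCalculus.
Context {R : realType} {m : nat}.

Definition tensor2 := 'I_m -> 'I_m -> 'rV[R]_m -> R.

Variable g : tensor2.

Definition ginv (i j : 'I_m) (u : 'rV[R]_m) : R :=
  invmx (\matrix_(k < m, l < m) g k l u) i j.

(* christoffel k i j = Gamma^k_ij *)
Definition christoffel (k i j : 'I_m) (u : 'rV[R]_m) : R :=
  2^-1 * \sum_(l < m)
    ginv k l u * (pd i (g j l) u + pd j (g i l) u - pd l (g i j) u).

(* nabla2 T a i j = nabla_a T_ij *)
Definition nabla2 (T : tensor2) (a i j : 'I_m) (u : 'rV[R]_m) : R :=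
  pd a (T i j) u
  - \sum_(k < m) christoffel k a i u * T k j u
  - \sum_(k < m) christoffel k a j u * T i k u.

(* nabla3 S b a i j = nabla_b S_aij *)
Definition nabla3 (S : 'I_m -> tensor2) (b a i j : 'I_m) (u : 'rV[R]_m) : R :=
  pd b (S a i j) u
  - \sum_(k < m) christoffel k b a u * S k i j u
  - \sum_(k < m) christoffel k b i u * S a k j u
  - \sum_(k < m) christoffel k b j u * S a i k u.

Definition tensor_laplacian (T : tensor2) : tensor2 := fun i j u =>
  \sum_(a < m) \sum_(b < m) ginv a b u * nabla3 (nabla2 T) b a i j u.

Definition covariant_hessian (F : 'rV[R]_m -> R) : tensor2 := fun i j u =>
  pd i (pd j F) u - \sum_(k < m) christoffel k i j u * pd k F u.

Definition tensor_trace (T : tensor2) (u : 'rV[R]_m) : R :=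
  \sum_(i < m) \sum_(j < m) ginv i j u * T i j u.

Definition tensor_square (T : tensor2) : tensor2 := fun i j u =>
  \sum_(k < m) \sum_(l < m) ginv k l u * T i k u * T l j u.

End TensorCalculus.

Section FundamentalForms.
Context {R : realType} {m : nat}.
Variables phi N : 'rV[R]_m -> 'rV[R]_m.+1.

Definition first_form : tensor2 := fun i j u =>
  dotv (tangent phi i u) (tangent phi j u).

(* h_ij = - <d_i d_j phi, N>.  For phi y = (y, f y), with E below the graph and
   hence N = (- grad f, 1) / sqrt (1 + |grad f|^2), this is
   - d_ij f / sqrt (1 + |grad f|^2): the second form of a ball is positive. *)
Definition second_form : tensor2 := fun i j u =>
  - dotv (\row_a pd i (pd j (coord_fun phi a)) u) (N u).

Definition mean_curvature : 'rV[R]_m -> R :=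
  tensor_trace first_form second_form.

Definition second_form_sq : tensor2 := tensor_square first_form second_form.

Definition second_form_norm2 : 'rV[R]_m -> R :=
  tensor_trace first_form second_form_sq.

End FundamentalForms.

(* Equality of 2-tensors at x, i.e. of all their components, in every local
   parametrization of the boundary around x. *)
Definition simons_identity_at {R : realType} {m : nat} (E : set 'rV[R]_m.+1)
    (x : 'rV[R]_m.+1) : Prop :=
  forall (U : set 'rV[R]_m) (phi N : 'rV[R]_m -> 'rV[R]_m.+1) (u : 'rV[R]_m),
  boundary_chart E U phi N -> U u -> phi u = x ->
  forall i j : 'I_m,
    tensor_laplacian (first_form phi) (second_form phi N) i j u =
      covariant_hessian (first_form phi) (mean_curvature phi N) i j u
      + mean_curvature phi N u * second_form_sq phi N i j u
      - second_form_norm2 phi N u * second_form phi N i j u.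

(* Main.v *)
Require Import Defs.
From mathcomp Require Import all_boot all_order all_algebra.
From mathcomp Require Import all_classical all_reals all_analysis.
From mathcomp Require Import ring.

(** Simons' identity is a local identity, a consequence of the equations of
    Gauss and Codazzi, and it is checked in an arbitrary chart.  Fix one, let the
    rows of the matrix X be the coordinate tangent vectors, N the normal,
    g = X X^T the metric and G its inverse.

    Since X and N together form a basis of the ambient space, the derivatives of
    the frame are determined by their products with X and N: this gives the
    formulas d_i X = conn_i X - h_i N of Gauss and d_i N = h_i^T G X of Weingarten
    ([gauss_formula], [weingarten_formula]), where h_i is the i-th column of the
    second fundamental form and the matrix conn_i consists of the Christoffel
    symbols ([christoffelE]).  Second derivatives of X commute
    ([mixed_derivatives_commute]); comparing the coefficients of X and of N in
    d_b d_i X = d_i d_b X yields the equations of Gauss, which express the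
    curvature as (h_i h_b^T - h_b h_i^T) G, and of Codazzi ([frame_flat]).

    In matrix notation the covariant derivative of a 2-tensor T is
    D_i T = d_i T - conn_i T - T conn_i^T, so that the Ricci identity is the
    computation of a commutator, [D_b, D_i] T = - (K T + T K^T), with K the
    curvature ([cov_commutator]).  By Codazzi the tensor of components
    (D_a h)_ij is totally symmetric, so in the second covariant derivative
    h_ij;ab the last derivative b is the only index with a distinguished place.
    Hence the trace of h_ij;ab over a and b becomes the trace of h_ba;ji,
    at the price of one commutation of covariant derivatives.  The latter trace is
    the Hessian of the mean curvature because G is parallel ([hess_mean]), and
    the curvature terms contract to H h^2 - c^2 h after two cubic terms have
    cancelled ([structural_simons]). *)

Set Implicit Arguments.
Unset Strict Implicit.
Unset Printing Implicit Defensive.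

Import Order.TTheory GRing.Theory Num.Theory.
Import numFieldNormedType.Exports.

Local Open Scope classical_set_scope.
Local Open Scope ring_scope.

(** * Symmetry of second derivatives *)

Section MixedDerivatives.
Context {R : realType} {V : normedModType R}.
Implicit Types (f : V -> R) (u v w : V).

Lemma is_derive_line f u v (s : R) : derivable f (u + s *: v) v ->
  is_derive s 1 (fun t : R => f (u + t *: v)) ('D_v f (u + s *: v)).
Proof.
move=> dfv.
have E : (fun h : R => h^-1 *: (((fun t : R => f (u + t *: v)) \o shift s) (h *: 1)
    - f (u + s *: v)))
  = (fun h => h^-1 *: ((f \o shift (u + s *: v)) (h *: v) - f (u + s *: v))).
  apply/funext => h /=; congr (_ *: (f _ - _)).
  by rewrite scalerDl [h *: 1]mulr1 addrCA.
split; first by rewrite /derivable E.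
by rewrite /derive E.
Qed.

Lemma is_derive_translate f u v w : derivable f (u + w) v ->
  is_derive u v (fun y => f (y + w)) ('D_v f (u + w)).
Proof.
move=> dfv.
have E : (fun h : R => h^-1 *: (((fun y => f (y + w)) \o shift u) (h *: v) - f (u + w)))
  = (fun h => h^-1 *: ((f \o shift (u + w)) (h *: v) - f (u + w))).
  by apply/funext => h /=; rewrite addrA.
split; first by rewrite /derivable E.
by rewrite /derive E.
Qed.

Lemma MVT_line f u v (t : R) : 0 < t ->
  (forall s, 0 <= s <= t -> derivable f (u + s *: v) v) ->
  exists2 s, 0 <= s <= t & f (u + t *: v) - f u = t * 'D_v f (u + s *: v).
Proof.
move=> t0 df.
have dl s : 0 <= s <= t ->
    is_derive s 1 (fun r : R => f (u + r *: v)) ('D_v f (u + s *: v)).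
  by move=> /df; exact: is_derive_line.
have [||s] := @MVT _ (fun r : R => f (u + r *: v))
  (fun s => 'D_v f (u + s *: v)) 0 t t0.
- by move=> s /andP[/ltW s0 /ltW st]; apply: dl; rewrite s0.
- apply: derivable_within_continuous => s; rewrite in_itv /= => /dl ds.
  exact: ex_derive.
- rewrite in_itv /= scale0r addr0 subr0 mulrC => /andP[/ltW s0 /ltW st] E.
  by exists s => //; rewrite s0.
Qed.

(** The second difference of f at u along the parallelogram spanned by t v and t w.
    It is symmetric in v and w, whence the symmetry of second derivatives. *)
Definition mixed_difference f u v w (t : R) : R :=
  (f (u + t *: v + t *: w) - f (u + t *: v)) - (f (u + t *: w) - f u).

(** Two applications of the mean value theorem, first along v and then along w,
    give the quotient as a value of 'D_w ('D_v f) at a point that tends to u. *)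
Lemma cvg_mixed_difference f u v w :
  (\forall y \near u, derivable f y v) ->
  (\forall y \near u, derivable ('D_v f) y w) ->
  {for u, continuous ('D_w ('D_v f))} ->
  (fun t => mixed_difference f u v w t / t ^+ 2) @ 0^'+ --> 'D_w ('D_v f) u.
Proof.
move=> dfv dfvw cfvw; apply/cvgrPdist_le => e e0.
have near_good : \forall y \near u, [/\ derivable f y v,
    derivable ('D_v f) y w & `|'D_w ('D_v f) u - 'D_w ('D_v f) y| <= e].
  move/cvgrPdist_le : cfvw => /(_ _ e0) cfvw.
  by apply: filterS3 dfv dfvw cfvw => y dv dvw dist; split.
have /nbhs_ballP[d /= d0 good] := near_good.
have k0 : 0 < `|v| + `|w| + 1 by rewrite ltr_wpDl// addr_ge0.
near=> t.
have t0 : 0 < t by near: t; exact: nbhs_right_gt.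
have td : t * (`|v| + `|w| + 1) < d.
  rewrite -ltr_pdivlMr//; near: t; apply: nbhs_right_lt; exact: divr_gt0.
have in_ball (s r : R) : 0 <= s <= t -> 0 <= r <= t ->
    ball u d (u + s *: v + r *: w).
  move=> /andP[s0 st] /andP[r0 rt]; rewrite -ball_normE /= -addrA opprD addNKr.
  rewrite normrN (le_lt_trans (ler_normD _ _))// !normrZ !ger0_norm//.
  apply: le_lt_trans td; rewrite !mulrDr mulr1 ler_wpDr ?(ltW t0)//.
  by rewrite lerD// ler_wpM2r.
have tt : 0 <= t <= t by rewrite ltW//=.
have zt : (0 : R) <= 0 <= t by rewrite lexx ltW.
(* The mixed difference is an increment of F along v. *)
pose F y := f (y + t *: w) - f y.
have dF s : 0 <= s <= t -> is_derive (u + s *: v) v F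
    ('D_v f (u + s *: v + t *: w) - 'D_v f (u + s *: v)).
  move=> st.
  have [d1 _ _] := good _ (in_ball _ _ st tt).
  have [d2 _ _] := good _ (in_ball _ _ st zt).
  rewrite scale0r addr0 in d2.
  exact: (is_deriveB (is_derive_translate d1) (derivableP d2)).
have [s st Fs] := MVT_line t0 (fun s st => @ex_derive _ _ _ _ _ _ _ (dF s st)).
have [|r rt Fr] := @MVT_line ('D_v f) (u + s *: v) w t t0.
  by move=> r rt; have [_ ?] := good _ (in_ball _ _ st rt).
have -> : mixed_difference f u v w t = t ^+ 2 * 'D_w ('D_v f) (u + s *: v + r *: w).
  rewrite /mixed_difference -[f (u + t *: w) - f u]/(F u).
  rewrite -[f _ - f _]/(F (u + t *: v)) Fs (derive_val (is_derive := dF s st)) Fr.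
  by rewrite expr2 mulrA.
rewrite mulrAC mulfV ?mul1r; last by rewrite expf_neq0 ?gt_eqF.
by have [] := good _ (in_ball _ _ st rt).
Unshelve. all: by end_near. Qed.

(** Both mixed derivatives are the limit of the same difference quotient. *)
Lemma mixed_derivatives_commute f u v w :
  (\forall y \near u, derivable f y v /\ derivable f y w) ->
  (\forall y \near u, derivable ('D_v f) y w /\ derivable ('D_w f) y v) ->
  {for u, continuous ('D_w ('D_v f))} -> {for u, continuous ('D_v ('D_w f))} ->
  'D_w ('D_v f) u = 'D_v ('D_w f) u.
Proof.
move=> df ddf c1 c2.
have sym : mixed_difference f u w v = mixed_difference f u v w.
  apply/funext => t; rewrite /mixed_difference [u + _ + _]addrAC; ring.
have H1 : (fun t => mixed_difference f u v w t / t ^+ 2) @ 0^'+ --> 'D_w ('D_v f) u.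
  by apply: cvg_mixed_difference c1; [move: df|move: ddf]; apply: filterS => ? [].
have H2 : (fun t => mixed_difference f u w v t / t ^+ 2) @ 0^'+ --> 'D_v ('D_w f) u.
  by apply: cvg_mixed_difference c2; [move: df|move: ddf]; apply: filterS => ? [].
rewrite sym in H2; exact: cvg_unique H1 H2.
Qed.

End MixedDerivatives.

(** * Smooth functions and their partial derivatives *)

Section SmoothFunctions.
Context {R : realType} {m : nat}.
Variable U : set 'rV[R]_m.
Hypothesis U_open : open U.
Implicit Types (f g : 'rV[R]_m -> R) (i j : 'I_m) (u : 'rV[R]_m).

Definition eq_on {T} (f g : 'rV[R]_m -> T) := forall u, U u -> f u = g u.

Lemma eq_on_near T (f g : 'rV[R]_m -> T) u : eq_on f g -> U u -> {near u, f =1 g}.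
Proof.
by move=> fg Uu; apply: filterS (open_nbhs_nbhs (conj U_open Uu)) => v /fg.
Qed.

Lemma eq_on_pd f g i : eq_on f g -> eq_on (pd i f) (pd i g).
Proof. by move=> fg u Uu; apply: near_eq_derive; exact: eq_on_near. Qed.

Lemma eq_on_derivable f g u v : eq_on f g -> U u ->
  derivable f u v -> derivable g u v.
Proof. by move=> fg Uu; apply: near_eq_derivable; exact: eq_on_near. Qed.

Lemma eq_on_continuous f g u : eq_on f g -> U u ->
  {for u, continuous f} -> {for u, continuous g}.
Proof.
move=> fg Uu cf; rewrite /prop_for /continuous_at -(fg _ Uu).
exact: cvg_trans (near_eq_cvg (eq_on_near fg Uu)) cf.
Qed.

(** This reduces smoothness to conditions of first order: by induction on s, each
    iterated derivative pds s f agrees on U with a member of P. *)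
Lemma smooth_coind (P : ('rV[R]_m -> R) -> Prop) :
  (forall f, P f -> forall u, U u ->
     {for u, continuous f} /\ forall i, derivable f u (delta_mx 0 i)) ->
  (forall f i, P f -> exists2 g, P g & eq_on (pd i f) g) ->
  forall f, P f -> smooth_on U f.
Proof.
move=> PC Pd f Pf.
have rep s : exists2 g, P g & eq_on (pds s f) g.
  elim: s => [|i s [g Pg fg]]; first by exists f.
  have [h Ph gh] := Pd g i Pg; exists h => //= u Uu.
  by rewrite (eq_on_pd i fg Uu) gh.
move=> s u Uu; have [g Pg fg] := rep s.
have gf : eq_on g (pds s f) by move=> v /fg.
have [cg dg] := PC g Pg u Uu.
by split=> [|i]; [exact: eq_on_continuous cg|exact: eq_on_derivable (dg i)].
Qed.

Lemma smooth_continuous f u : smooth_on U f -> U u -> {for u, continuous f}.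
Proof. by move=> sf Uu; have [] := sf [::] u Uu. Qed.

Lemma smooth_derivable f u i : smooth_on U f -> U u ->
  derivable f u (delta_mx 0 i).
Proof. by move=> sf Uu; have [] := sf [::] u Uu. Qed.

Lemma smooth_pd f i : smooth_on U f -> smooth_on U (pd i f).
Proof.
move=> sf s u Uu; have -> : pds s (pd i f) = pds (rcons s i) f.
  by elim: s => //= j s ->.
exact: sf.
Qed.

(** Expressions in smooth functions are closed under differentiation, which is
    all that [smooth_coind] asks for; the smoothness of sums, products and
    inverses thus follows at one stroke from the first-order rules. *)
Inductive smooth_expr : ('rV[R]_m -> R) -> Prop :=
| SmoothVar f of smooth_on U f : smooth_expr f
| SmoothCst c : smooth_expr (cst c)
| SmoothAdd f g of smooth_expr f & smooth_expr g : smooth_expr (f + g)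
| SmoothMul f g of smooth_expr f & smooth_expr g : smooth_expr (f * g)
| SmoothInv f of smooth_expr f & (forall u, U u -> f u != 0) :
    smooth_expr (fun u => (f u)^-1).

Lemma smooth_expr_C1 f u : smooth_expr f -> U u ->
  {for u, continuous f} /\ forall i, derivable f u (delta_mx 0 i).
Proof.
(* V fixes the normed structure from which the topology of row vectors comes. *)
pose V : normedModType R := 'rV[R]_m.
move=> sf Uu; elim: {f} sf => [f sf|c|f g _ [cf df] _ [cg dg]
  |f g _ [cf df] _ [cg dg]|f _ [cf df] f0].
- exact: (sf [::] u Uu).
- split=> [|i]; first exact: (@cst_continuous V R c u).
  exact: (@derivable_cst _ V R c u _).
- split=> [|i]; first exact: (@continuousD R R V f g u cf cg).
  exact: derivableD.
- split=> [|i]; first exact: (@continuousM R V f g u cf cg).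
  exact: derivableM.
- split=> [|i]; first exact: (@continuousV R V f u (f0 u Uu) cf).
  by apply: derivableV => //; exact: f0.
Qed.

Lemma smooth_expr_pd f i : smooth_expr f ->
  exists2 g, smooth_expr g & eq_on (pd i f) g.
Proof.
have dE g u : smooth_expr g -> U u -> derivable g u (delta_mx 0 i : 'rV[R]_m).
  by move=> /smooth_expr_C1 /[apply] -[].
elim=> {f} [f sf|c|f g sf [f' sf' ff'] sg [g' sg' gg']
  |f g sf [f' sf' ff'] sg [g' sg' gg']|f sf [f' sf' ff'] f0].
- by exists (pd i f) => //; apply: SmoothVar; exact: smooth_pd.
- by exists (cst 0) => [|u Uu]; [exact: SmoothCst|rewrite /pd derive_cst].
- exists (f' + g') => [|u Uu]; first exact: SmoothAdd.
  rewrite /pd deriveD; [|exact: dE..]; congr (_ + _); [exact: ff'|exact: gg'].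
- exists (f * g' + g * f') => [|u Uu].
    by apply: SmoothAdd; exact: SmoothMul.
  rewrite /pd deriveM; [|exact: dE..]; congr (_ + _); congr (_ * _); first exact: gg'.
  exact: ff'.
- exists (cst (- 1) * ((fun u => (f u)^-1) * (fun u => (f u)^-1) * f')) => [|u Uu].
    apply: SmoothMul; first exact: SmoothCst.
    by apply: SmoothMul => //; apply: SmoothMul; exact: SmoothInv.
  rewrite /pd deriveV; [|exact: f0|exact: dE]; rewrite [X in _ *: X](ff' u Uu).
  by rewrite /= mulN1r -exprVn expr2 scaleNr.
Qed.

Lemma smooth_of_expr f : smooth_expr f -> smooth_on U f.
Proof.
apply: (smooth_coind (P := smooth_expr)) => [g sg u|g i].
  exact: smooth_expr_C1.
exact: smooth_expr_pd.
Qed.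

Lemma eq_on_smooth f g : eq_on f g -> smooth_on U f -> smooth_on U g.
Proof.
move=> fg sf.
apply: (smooth_coind (P := fun h => exists2 k, smooth_on U k & eq_on k h)).
- move=> h [k sk kh] u Uu; split=> [|i].
    by apply: eq_on_continuous kh _ _ => //; exact: smooth_continuous.
  by apply: eq_on_derivable kh _ _ => //; exact: smooth_derivable.
- move=> h i [k sk kh]; exists (pd i h) => //.
  by exists (pd i k); [exact: smooth_pd|exact: eq_on_pd].
- by exists f.
Qed.

Lemma smooth_cst c : smooth_on U (fun=> c).
Proof. exact/smooth_of_expr/SmoothCst. Qed.

Lemma smoothD f g : smooth_on U f -> smooth_on U g ->
  smooth_on U (fun u => f u + g u).
Proof. by move=> sf sg; apply/smooth_of_expr/SmoothAdd; exact: SmoothVar. Qed.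

Lemma smoothM f g : smooth_on U f -> smooth_on U g ->
  smooth_on U (fun u => f u * g u).
Proof. by move=> sf sg; apply/smooth_of_expr/SmoothMul; exact: SmoothVar. Qed.

Lemma smoothV f : smooth_on U f -> (forall u, U u -> f u != 0) ->
  smooth_on U (fun u => (f u)^-1).
Proof. by move=> sf f0; apply/smooth_of_expr/SmoothInv => //; exact: SmoothVar. Qed.

Lemma smoothN f : smooth_on U f -> smooth_on U (fun u => - f u).
Proof.
move=> sf; have -> : (fun u => - f u) = (fun u => -1 * f u).
  by apply/funext => u; rewrite mulN1r.
by apply: smoothM sf; exact: smooth_cst.
Qed.

Lemma smooth_sum (I : Type) (r : seq I) (F : I -> 'rV[R]_m -> R) :
  (forall k, smooth_on U (F k)) -> smooth_on U (fun u => \sum_(k <- r) F k u).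
Proof.
move=> sF; elim: r => [|k r IH].
  by under eq_fun do rewrite big_nil; exact: smooth_cst.
by under eq_fun do rewrite big_cons; exact: smoothD (sF k) IH.
Qed.

Lemma smooth_prod (I : Type) (r : seq I) (F : I -> 'rV[R]_m -> R) :
  (forall k, smooth_on U (F k)) -> smooth_on U (fun u => \prod_(k <- r) F k u).
Proof.
move=> sF; elim: r => [|k r IH].
  by under eq_fun do rewrite big_nil; exact: smooth_cst.
by under eq_fun do rewrite big_cons; exact: smoothM (sF k) IH.
Qed.

Lemma pdD f g i u : smooth_on U f -> smooth_on U g -> U u ->
  pd i (fun v => f v + g v) u = pd i f u + pd i g u.
Proof. by move=> sf sg Uu; rewrite /pd deriveD//; exact: smooth_derivable. Qed.

Lemma pdN f i u : smooth_on U f -> U u -> pd i (fun v => - f v) u = - pd i f u.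
Proof. by move=> sf Uu; rewrite /pd deriveN//; exact: smooth_derivable. Qed.

Lemma pdM f g i u : smooth_on U f -> smooth_on U g -> U u ->
  pd i (fun v => f v * g v) u = pd i f u * g u + f u * pd i g u.
Proof.
move=> sf sg Uu; rewrite /pd deriveM; [|exact: smooth_derivable..].
by rewrite addrC [_ *: 'D__ f u]mulrC.
Qed.

Lemma pd_cst c i u : pd i (fun=> c) u = 0.
Proof. exact: derive_cst. Qed.

Lemma pd_sum (I : Type) (r : seq I) (F : I -> 'rV[R]_m -> R) i u :
  (forall k, smooth_on U (F k)) -> U u ->
  pd i (fun v => \sum_(k <- r) F k v) u = \sum_(k <- r) pd i (F k) u.
Proof.
move=> sF Uu; elim: r => [|k r IH].
  by under eq_fun do rewrite big_nil; rewrite pd_cst big_nil.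
under eq_fun do rewrite big_cons; rewrite pdD//; last exact: smooth_sum.
by rewrite IH big_cons.
Qed.

Lemma pdC f i j : smooth_on U f -> eq_on (pd i (pd j f)) (pd j (pd i f)).
Proof.
move=> sf u Uu; have nU := open_nbhs_nbhs (conj U_open Uu).
apply: mixed_derivatives_commute.
- by apply: filterS nU => v Uv; split; exact: smooth_derivable.
- apply: filterS nU => v Uv.
  have dd k l : derivable (pd k f) v (delta_mx 0 l : 'rV[R]_m).
    exact: smooth_derivable (smooth_pd _ sf) Uv.
  by split; [exact: (dd j i)|exact: (dd i j)].
- by apply: smooth_continuous Uu; do 2 apply: smooth_pd.
- by apply: smooth_continuous Uu; do 2 apply: smooth_pd.
Qed.

End SmoothFunctions.

(** * Matrix-valued functions *)

Section MatrixFunctions.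
Context {R : realType} {m : nat}.
Variable U : set 'rV[R]_m.
Hypothesis U_open : open U.
Implicit Types (i j : 'I_m) (u : 'rV[R]_m) (p q r : nat).

Definition pdmx p q i (M : 'rV[R]_m -> 'M[R]_(p, q)) u : 'M[R]_(p, q) :=
  \matrix_(a, b) pd i (fun v => M v a b) u.

Definition smooth_mx p q (M : 'rV[R]_m -> 'M[R]_(p, q)) :=
  forall a b, smooth_on U (fun u => M u a b).

Lemma smooth_mxD p q (M M' : 'rV[R]_m -> 'M[R]_(p, q)) :
  smooth_mx M -> smooth_mx M' -> smooth_mx (fun u => M u + M' u).
Proof.
by move=> sM sM' a b; under eq_fun do rewrite mxE; exact: smoothD (sM a b) (sM' a b).
Qed.

Lemma smooth_mxN p q (M : 'rV[R]_m -> 'M[R]_(p, q)) :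
  smooth_mx M -> smooth_mx (fun u => - M u).
Proof. by move=> sM a b; under eq_fun do rewrite mxE; exact: smoothN (sM a b). Qed.

Lemma smooth_mxM p q r (M : 'rV[R]_m -> 'M[R]_(p, q)) (M' : 'rV[R]_m -> 'M[R]_(q, r)) :
  smooth_mx M -> smooth_mx M' -> smooth_mx (fun u => M u *m M' u).
Proof.
move=> sM sM' a b; under eq_fun do rewrite mxE.
by apply: smooth_sum => // k; exact: smoothM (sM a k) (sM' k b).
Qed.

Lemma smooth_mx_tr p q (M : 'rV[R]_m -> 'M[R]_(p, q)) :
  smooth_mx M -> smooth_mx (fun u => (M u)^T).
Proof. by move=> sM a b; under eq_fun do rewrite mxE; exact: sM. Qed.

Lemma smooth_pdmx p q i (M : 'rV[R]_m -> 'M[R]_(p, q)) :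
  smooth_mx M -> smooth_mx (pdmx i M).
Proof. by move=> sM a b; under eq_fun do rewrite mxE; exact: smooth_pd. Qed.

Lemma eq_on_smooth_mx p q (M M' : 'rV[R]_m -> 'M[R]_(p, q)) :
  eq_on U M M' -> smooth_mx M -> smooth_mx M'.
Proof. by move=> MM' sM a b; apply: eq_on_smooth (sM a b) => // u /MM' ->. Qed.

Lemma smooth_det p (M : 'rV[R]_m -> 'M[R]_p) :
  smooth_mx M -> smooth_on U (fun u => \det (M u)).
Proof.
move=> sM; apply: smooth_sum => // s; apply: smoothM; first exact: U_open.
  exact: smooth_cst.
by apply: smooth_prod => // k; exact: sM.
Qed.

(** Cramer's rule writes the inverse as a rational expression in the entries. *)
Lemma smooth_invmx p (M : 'rV[R]_m -> 'M[R]_p) :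
  smooth_mx M -> (forall u, U u -> M u \in unitmx) ->
  smooth_mx (fun u => invmx (M u)).
Proof.
move=> sM Mu; apply: (@eq_on_smooth_mx _ _ (fun u => (\det (M u))^-1 *: \adj (M u))).
  by move=> u Uu; rewrite /invmx Mu.
move=> a b; under eq_fun do rewrite mxE mxE /cofactor.
apply: smoothM; first exact: U_open.
  apply: smoothV => //; first exact: smooth_det.
  by move=> u /Mu; rewrite unitmxE unitfE.
apply: smoothM; first exact: U_open.
  exact: smooth_cst.
apply: smooth_det => c d; under eq_fun do rewrite !mxE; exact: sM.
Qed.

Lemma eq_on_pdmx p q i (M M' : 'rV[R]_m -> 'M[R]_(p, q)) :
  eq_on U M M' -> eq_on U (pdmx i M) (pdmx i M').
Proof.
move=> MM' u Uu; apply/matrixP => a b; rewrite !mxE.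
by apply: (eq_on_pd U_open) => // v /MM' ->.
Qed.

Lemma pdmxD p q i (M M' : 'rV[R]_m -> 'M[R]_(p, q)) u :
  smooth_mx M -> smooth_mx M' -> U u ->
  pdmx i (fun v => M v + M' v) u = pdmx i M u + pdmx i M' u.
Proof.
move=> sM sM' Uu; apply/matrixP => a b; rewrite !mxE.
by under eq_fun do rewrite mxE; exact: pdD (sM a b) (sM' a b) Uu.
Qed.

Lemma pdmxN p q i (M : 'rV[R]_m -> 'M[R]_(p, q)) u : smooth_mx M -> U u ->
  pdmx i (fun v => - M v) u = - pdmx i M u.
Proof.
move=> sM Uu; apply/matrixP => a b; rewrite !mxE.
by under eq_fun do rewrite mxE; exact: pdN (sM a b) Uu.
Qed.

Lemma pdmxM p q r i (M : 'rV[R]_m -> 'M[R]_(p, q)) (M' : 'rV[R]_m -> 'M[R]_(q, r)) u :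
  smooth_mx M -> smooth_mx M' -> U u ->
  pdmx i (fun v => M v *m M' v) u = pdmx i M u *m M' u + M u *m pdmx i M' u.
Proof.
move=> sM sM' Uu; apply/matrixP => a b; rewrite !mxE.
under eq_fun do rewrite mxE.
rewrite (pd_sum U_open)//; last by move=> k; exact: (smoothM U_open (sM a k) (sM' k b)).
rewrite -big_split; apply: eq_bigr => k _; rewrite !mxE.
exact: pdM (sM a k) (sM' k b) Uu.
Qed.

Lemma pdmx_tr p q i (M : 'rV[R]_m -> 'M[R]_(p, q)) u :
  pdmx i (fun v => (M v)^T) u = (pdmx i M u)^T.
Proof. by apply/matrixP => a b; rewrite !mxE; under eq_fun do rewrite mxE. Qed.

Lemma pdmx_cst p q i (A : 'M[R]_(p, q)) u : pdmx i (fun=> A) u = 0.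
Proof. by apply/matrixP => a b; rewrite !mxE pd_cst. Qed.

Lemma pdmxC p q i j (M : 'rV[R]_m -> 'M[R]_(p, q)) : smooth_mx M ->
  eq_on U (pdmx i (pdmx j M)) (pdmx j (pdmx i M)).
Proof.
move=> sM u Uu; apply/matrixP => a b; rewrite [LHS]mxE [RHS]mxE.
have dE k : (fun v => pdmx k M v a b) = pd k (fun v => M v a b).
  by apply/funext => v; rewrite mxE.
by rewrite !dE; exact: (pdC U_open _ _ (sM a b) Uu).
Qed.

Lemma pd_mxtrace p i (M : 'rV[R]_m -> 'M[R]_p) u : smooth_mx M -> U u ->
  pd i (fun v => \tr (M v)) u = \tr (pdmx i M u).
Proof.
move=> sM Uu; rewrite (pd_sum U_open _ _ (fun k => sM k k) Uu).
by rewrite /mxtrace; apply: eq_bigr => k _; rewrite mxE.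
Qed.

End MatrixFunctions.

(** * From the structure equations to Simons' identity *)

Section StructureEquations.
Context {R : realType} {m : nat}.
Variable U : set 'rV[R]_m.
Hypothesis U_open : open U.

(** conn i is the matrix with entries (conn i) j k = Gamma^k_ij, G the inverse
    metric and h the second fundamental form.  They are subject to
    the structure equations assumed below. *)
Variables (conn : 'I_m -> 'rV[R]_m -> 'M[R]_m) (G h : 'rV[R]_m -> 'M[R]_m).
Implicit Types (i j k a b : 'I_m) (u : 'rV[R]_m) (T : 'rV[R]_m -> 'M[R]_m).

(** Since (conn i) j k = Gamma^k_ij, both Christoffel corrections of the covariant
    derivative nabla_i T are matrix products. *)
Definition cov i (T : 'rV[R]_m -> 'M[R]_m) u : 'M[R]_m :=
  pdmx i T u - conn i u *m T u - T u *m (conn i u)^T.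

(** The components are nabla_b nabla_a T_ij.  The sum is the correction for the
    index a, which is a mere label in cov b (cov a T). *)
Definition cov2 b a (T : 'rV[R]_m -> 'M[R]_m) u : 'M[R]_m :=
  cov b (cov a T) u - \sum_k conn b u a k *: cov k T u.

Definition mean u : R := \tr (G u *m h u).
Definition sff2 u : 'M[R]_m := h u *m G u *m h u.

(** The curvature of the connection.  The products come in the order opposite to
    the usual one because conn i is the transpose of the usual connection matrix. *)
Definition curv b i u : 'M[R]_m :=
  pdmx b (conn i) u - pdmx i (conn b) u + conn i u *m conn b u - conn b u *m conn i u.

Hypothesis conn_smooth : forall i, smooth_mx U (conn i).
Hypothesis G_smooth : smooth_mx U G.
Hypothesis h_smooth : smooth_mx U h.
Hypothesis conn_torsion_free : forall i j k u, U u -> conn i u j k = conn j u i k.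
Hypothesis h_sym : forall u, U u -> (h u)^T = h u.
Hypothesis G_parallel : forall k u, U u ->
  pdmx k G u = - (G u *m conn k u) - (conn k u)^T *m G u.
Hypothesis gauss_equation : forall b i u, U u ->
  curv b i u = (col i (h u) *m row b (h u) - col b (h u) *m row i (h u)) *m G u.
Hypothesis codazzi_equation : forall b i u, U u ->
  pdmx b (fun v => col i (h v)) u + conn i u *m col b (h u)
  = pdmx i (fun v => col b (h v)) u + conn b u *m col i (h u).

Lemma smooth_cov i T : smooth_mx U T -> smooth_mx U (cov i T).
Proof.
move=> sT; have sc := conn_smooth i; have sct := smooth_mx_tr sc.
have sCT := smooth_mxM U_open sc sT; have sTC := smooth_mxM U_open sT sct.
have sdT := smooth_pdmx i sT.
exact: (smooth_mxD U_open (smooth_mxD U_open sdT (smooth_mxN U_open sCT))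
  (smooth_mxN U_open sTC)).
Qed.

Lemma pdmx_cov b i T u : smooth_mx U T -> U u ->
  pdmx b (cov i T) u = pdmx b (pdmx i T) u
    - (pdmx b (conn i) u *m T u + conn i u *m pdmx b T u)
    - (pdmx b T u *m (conn i u)^T + T u *m (pdmx b (conn i) u)^T).
Proof.
move=> sT Uu; have sc := conn_smooth i; have sct := smooth_mx_tr sc.
have sdT := smooth_pdmx i sT.
have sCT := smooth_mxM U_open sc sT; have sTC := smooth_mxM U_open sT sct.
have sD := smooth_mxD U_open sdT (smooth_mxN U_open sCT).
rewrite (pdmxD _ sD (smooth_mxN U_open sTC) Uu).
rewrite (pdmxD _ sdT (smooth_mxN U_open sCT) Uu) (pdmxN _ sCT Uu) (pdmxN _ sTC Uu).
by rewrite (pdmxM U_open _ sc sT Uu) (pdmxM U_open _ sT sct Uu) pdmx_tr.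
Qed.

(** The Ricci identity for 2-tensors; the correction for the index of the inner
    derivative, absent here, is symmetric in b and i. *)
Lemma cov_commutator b i T u : smooth_mx U T -> U u ->
  cov b (cov i T) u - cov i (cov b T) u
  = - (curv b i u *m T u + T u *m (curv b i u)^T).
Proof.
move=> sT Uu; rewrite [cov b _ u]/cov [cov i (cov b T) u]/cov !pdmx_cov//.
rewrite (pdmxC U_open i b)// /cov /curv.
move: (pdmx b (pdmx i T) u) (pdmx b (conn i) u) (pdmx i (conn b) u) (pdmx b T u)
  (pdmx i T u) (conn b u) (conn i u) (T u) => D dA dB Tb Ti B A M.
have trD (P Q : 'M[R]_m) : (P + Q)^T = P^T + Q^T by exact: linearD.
have trN (P : 'M[R]_m) : (- P)^T = - P^T by exact: linearN.
rewrite !(trD, trN, trmx_mul, mulmxDl, mulmxDr, mulNmx, mulmxN, opprD, opprK, mulmxA).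
have addE (P Q : 'M[R]_m) x y : (P + Q) x y = P x y + Q x y by rewrite mxE.
have oppE (P : 'M[R]_m) x y : (- P) x y = - P x y by rewrite mxE.
by apply/matrixP => x y; rewrite !(addE, oppE); ring.
Qed.

Lemma covE b T u i j : cov b T u i j = pd b (fun v => T v i j) u
  - \sum_k conn b u i k * T u k j - \sum_k conn b u j k * T u i k.
Proof.
rewrite /cov !mxE; congr (_ - _); apply: eq_bigr => k _.
by rewrite mxE mulrC.
Qed.

Lemma cov2E b a T u i j : cov2 b a T u i j = cov b (cov a T) u i j
  - \sum_k conn b u a k * cov k T u i j.
Proof.
rewrite /cov2 mxE [X in _ + X]mxE summxE; congr (_ - _); apply: eq_bigr => k _.
by rewrite mxE.
Qed.

Lemma eq_on_cov i T T' : eq_on U T T' -> eq_on U (cov i T) (cov i T').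
Proof. by move=> TT' u Uu; rewrite /cov (eq_on_pdmx U_open i TT')// TT'. Qed.

Lemma cov_tr i T u : (cov i T u)^T = cov i (fun v => (T v)^T) u.
Proof.
apply/matrixP => a b; rewrite mxE !covE addrAC; congr (_ - _ - _).
- by congr (pd _ _ _); apply/funext => v; rewrite mxE.
- by apply: eq_bigr => k _; rewrite [(T u)^T _ _]mxE.
- by apply: eq_bigr => k _; rewrite [(T u)^T _ _]mxE.
Qed.

Lemma cov_sff_sym i : eq_on U (fun u => (cov i h u)^T) (cov i h).
Proof. by move=> u Uu; rewrite cov_tr; exact: (eq_on_cov i h_sym Uu). Qed.

Lemma cov_sff_symE i u a b : U u -> cov i h u a b = cov i h u b a.
Proof. by move=> Uu; rewrite -{1}(cov_sff_sym i Uu) mxE. Qed.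

Lemma cov2_sff_sym b a u i j : U u -> cov2 b a h u i j = cov2 b a h u j i.
Proof.
move=> Uu; rewrite !cov2E; congr (_ - _).
  by rewrite -{1}(eq_on_cov b (cov_sff_sym a) Uu) -cov_tr mxE.
by apply: eq_bigr => k _; rewrite cov_sff_symE.
Qed.

(** The derivative part of nabla_a h_ij is symmetric in a and i by Codazzi, once
    the correction for the index j is included; the remaining correction is
    symmetric because the connection is torsion free. *)
Lemma cov_codazzi i j a u : U u -> cov a h u i j = cov i h u a j.
Proof.
move=> Uu.
have key b c : cov b h u j c
    = (pdmx b (fun v => col c (h v)) u - conn b u *m col c (h u)) j 0
      - \sum_k conn b u c k * h u j k.
  rewrite covE; congr (_ - _); rewrite [RHS]mxE [X in _ = _ + X]mxE; congr (_ - _).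
    by rewrite mxE; congr (pd _ _ _); apply/funext => v; rewrite mxE.
  by rewrite mxE; apply: eq_bigr => k _; rewrite [col _ _ _ _]mxE.
have tf : \sum_k conn a u i k * h u j k = \sum_k conn i u a k * h u j k.
  by apply: eq_bigr => k _; rewrite conn_torsion_free.
have E : pdmx a (fun v => col i (h v)) u - conn a u *m col i (h u)
    = pdmx i (fun v => col a (h v)) u - conn i u *m col a (h u).
  by apply/eqP; rewrite subr_eq addrAC codazzi_equation// addrK.
by rewrite cov_sff_symE// [RHS]cov_sff_symE// (key a i) (key i a) tf E.
Qed.

(** Differentiating the total symmetry of nabla h: b is the only index of
    nabla_b nabla_a h_ij that does not move freely. *)
Lemma cov2_codazzi b a i j u : U u -> cov2 b a h u i j = cov2 b i h u a j.
Proof.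
move=> Uu; rewrite !cov2E !covE.
have -> : pd b (fun v => cov a h v i j) u = pd b (fun v => cov i h v a j) u.
  by apply: (eq_on_pd U_open) => // v Uv; exact: cov_codazzi.
rewrite [LHS](ACl (1*4*3*2)) /=; congr (_ - _ - _ - _).
- by apply: eq_bigr => k _; rewrite cov_codazzi.
- by apply: eq_bigr => k _; rewrite cov_codazzi.
- by apply: eq_bigr => k _; rewrite cov_codazzi.
Qed.

Lemma curv_sff b i a j u : U u ->
  (curv b i u *m h u) a j = h u a i * sff2 u b j - h u a b * sff2 u i j.
Proof.
move=> Uu; rewrite gauss_equation// !mulmxBl.
have E c d : (col c (h u) *m row d (h u) *m G u *m h u) a j = h u a c * sff2 u d j.
  rewrite -!mulmxA mxE big_ord1 [col _ _ _ _]mxE !mulmxA -!row_mul.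
  by rewrite [row _ _ _ _]mxE.
by rewrite mxE [X in _ + X]mxE !E.
Qed.

(** The Ricci identity for h, with the curvature eliminated by Gauss' equation. *)
Lemma cov2_commutator b i a j u : U u ->
  cov2 b i h u a j = cov2 i b h u a j
    - (h u a i * sff2 u b j - h u a b * sff2 u i j
       + (h u j i * sff2 u b a - h u j b * sff2 u i a)).
Proof.
move=> Uu; rewrite !cov2E -!curv_sff//.
have -> : (curv b i u *m h u) j a = (h u *m (curv b i u)^T) a j.
  by rewrite -[h u in RHS]h_sym// -trmx_mul [RHS]mxE.
have E : cov b (cov i h) u
    = cov i (cov b h) u - (curv b i u *m h u + h u *m (curv b i u)^T).
  by rewrite -cov_commutator// addrC subrK.
have entry (P Q S : 'M[R]_m) : (P - (Q + S)) a j = P a j - (Q a j + S a j).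
  by rewrite !mxE.
have -> : \sum_k conn b u i k * cov k h u a j = \sum_k conn i u b k * cov k h u a j.
  by apply: eq_bigr => k _; rewrite conn_torsion_free.
by rewrite E entry addrAC.
Qed.

(** Traces commute with covariant differentiation since the metric is parallel. *)
Lemma pd_trace k T u : smooth_mx U T -> U u ->
  pd k (fun v => \tr (G v *m T v)) u = \tr (G u *m cov k T u).
Proof.
move=> sT Uu.
rewrite (pd_mxtrace U_open _ (smooth_mxM U_open G_smooth sT) Uu).
rewrite (pdmxM U_open _ G_smooth sT Uu) G_parallel// /cov.
have E : \tr ((conn k u)^T *m G u *m T u) = \tr (G u *m T u *m (conn k u)^T).
  by rewrite -mulmxA mxtrace_mulC.
rewrite mulmxBl mulNmx !mulmxBr !mulmxA !raddfD /= !raddfN /= E.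
by rewrite [LHS](ACl (3*1*2)).
Qed.

Lemma pd_mean k u : U u -> pd k mean u = \tr (G u *m cov k h u).
Proof. exact: pd_trace h_smooth. Qed.

(** Both derivatives pass through the trace, and so does the Christoffel
    correction for the index j. *)
Lemma hess_mean i j u : U u ->
  pd i (pd j mean) u - \sum_k conn i u j k * pd k mean u = \tr (G u *m cov2 i j h u).
Proof.
move=> Uu; have sh := h_smooth.
rewrite (eq_on_pd U_open i (pd_mean j))// (pd_trace _ (smooth_cov j sh) Uu).
have -> : G u *m cov2 i j h u
    = G u *m cov i (cov j h) u - \sum_k conn i u j k *: (G u *m cov k h u).
  rewrite /cov2 mulmxBr mulmx_sumr; congr (_ - _).
  by apply: eq_bigr => k _; rewrite scalemxAr.
rewrite [RHS]raddfB; congr (_ - _).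
rewrite raddf_sum /=; apply: eq_bigr => k _.
by rewrite pd_mean// mxtraceZ.
Qed.

Lemma mxtrace_mulE (A B : 'M[R]_m) : \tr (A *m B) = \sum_a \sum_b A a b * B b a.
Proof. by apply: eq_bigr => a _; rewrite mxE. Qed.

(** The factor of the middle matrix comes first, as in contractions with the
    inverse metric. *)
Lemma mulmx3E (A B C : 'M[R]_m) i j :
  (A *m B *m C) i j = \sum_a \sum_b B a b * (A i a * C b j).
Proof.
rewrite mxE exchange_big; apply: eq_bigr => b _; rewrite mxE mulr_suml.
by apply: eq_bigr => a _; rewrite mulrCA mulrA.
Qed.

(** Codazzi moves every index of nabla_b nabla_a h_ij but b, and Gauss pays for the
    single exchange of derivatives that is needed to move b as well; the curvature
    terms then contract to H h^2 - c^2 h. *)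
Lemma structural_simons i j u : U u ->
  \sum_a \sum_b G u a b * cov2 b a h u i j
  = pd i (pd j mean) u - \sum_k conn i u j k * pd k mean u
    + mean u * sff2 u i j - \tr (G u *m sff2 u) * h u i j.
Proof.
move=> Uu.
have hC a b : h u a b = h u b a by rewrite -{1}(h_sym Uu) mxE.
(* The indices travel along b;a,i,j -> b;i,a,j -> i;b,j,a -> i;j,b,a, where the
   middle arrow exchanges two derivatives and creates the curvature terms. *)
have E a b : G u a b * cov2 b a h u i j
   = G u a b * cov2 i j h u b a + (G u a b * h u b a * sff2 u i j)
     - G u a b * sff2 u b a * h u i j
     + (G u a b * (sff2 u i a * h u b j) - G u a b * (h u i a * sff2 u b j)).
  rewrite cov2_codazzi// cov2_commutator// cov2_sff_sym// cov2_codazzi//.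
  by rewrite (hC a i) (hC a b) (hC j i) (hC j b); ring.
under eq_bigr => a _ do
  [under eq_bigr => b _ do rewrite E; rewrite !(big_split, sumrN, sumrB) -!mulr_suml].
rewrite !(big_split, sumrN, sumrB) -!mulr_suml /= hess_mean// /mean !mxtrace_mulE.
rewrite -!mulmx3E.
(* Both cubic terms are h G h G h. *)
have -> : sff2 u *m G u *m h u = h u *m G u *m sff2 u by rewrite /sff2 !mulmxA.
by rewrite subrr addr0.
Qed.

End StructureEquations.

(** * Structure equations of a hypersurface *)

Section AdaptedFrame.
Context {R : realType} {m : nat}.
Variable U : set 'rV[R]_m.
Hypothesis U_open : open U.

(** An adapted frame: the rows of X u span the tangent space at the point with
    parameter u, and N u is the unit normal there. *)
Variables (X : 'rV[R]_m -> 'M[R]_(m, m.+1)) (N : 'rV[R]_m -> 'rV[R]_m.+1).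
Hypothesis X_smooth : smooth_mx U X.
Hypothesis N_smooth : smooth_mx U N.
Hypothesis X_free : forall u, U u -> row_free (X u).
Hypothesis X_ortho_N : forall u, U u -> X u *m (N u)^T = 0.
Hypothesis N_unit : forall u, U u -> N u *m (N u)^T = 1%:M.
(** The rows of X are the partial derivatives of one map. *)
Hypothesis X_integrable : forall i j u, U u ->
  row j (pdmx i X u) = row i (pdmx j X u).
Implicit Types (i j k a b : 'I_m) (u : 'rV[R]_m).

Lemma frame_free p (A : 'M[R]_(p, m)) (B : 'M[R]_(p, 1)) u : U u ->
  A *m X u + B *m N u = 0 -> A = 0 /\ B = 0.
Proof.
move=> Uu E.
have BN : B *m N u = - (A *m X u) by apply/eqP; rewrite -addr_eq0 addrC E.
have B0 : B = 0.
  by rewrite -[B]mulmx1 -(N_unit Uu) mulmxA BN mulNmx -mulmxA X_ortho_N// mulmx0 oppr0.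
split=> //; apply/eqP; rewrite -(mulmx_free_eq0 A (X_free Uu)).
by rewrite -E B0 mul0mx addr0.
Qed.

(** X u and N u form a basis: their rows are independent, and there are m + 1 of
    them. *)
Lemma frame_complete p (W : 'M[R]_(p, m.+1)) u : U u ->
  W *m (X u)^T = 0 -> W *m (N u)^T = 0 -> W = 0.
Proof.
move=> Uu WX WN; pose F := col_mx (X u) (N u).
have F_free : row_free F.
  apply: inj_row_free => v; rewrite -[v]hsubmxK mul_row_col => E.
  by have [-> ->] := frame_free Uu E; rewrite row_mx0.
have Ft_free : row_free F^T.
  by rewrite /row_free mxrank_tr (eqP F_free) addn1.
apply/eqP; rewrite -(mulmx_free_eq0 W Ft_free).
by rewrite tr_col_mx mul_mx_row WX WN row_mx0.
Qed.

Definition metric u : 'M[R]_m := X u *m (X u)^T.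
Definition cometric u : 'M[R]_m := invmx (metric u).

(** The tangential part of the derivative of X, in the frame X: this is the
    Levi-Civita connection of the induced metric. *)
Definition conn i u : 'M[R]_m := pdmx i X u *m (X u)^T *m cometric u.

(** Minus the normal part of the derivative of X, a column of the second
    fundamental form. *)
Definition shape i u : 'cV[R]_m := - (pdmx i X u *m (N u)^T).
Definition sff u : 'M[R]_m := \matrix_(i, j) shape j u i 0.

Local Notation g := metric.
Local Notation G := cometric.
Local Notation h := sff.

Lemma metric_unit u : U u -> g u \in unitmx.
Proof.
move=> Uu; rewrite -row_free_unit; apply: inj_row_free => v; rewrite mulmxA => E.
apply/eqP; rewrite -(mulmx_free_eq0 v (X_free Uu)); apply/eqP.
by apply: (frame_complete Uu) => //; rewrite -mulmxA X_ortho_N// mulmx0.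
Qed.

Lemma metric_sym u : (g u)^T = g u.
Proof. by rewrite trmx_mul trmxK. Qed.

Lemma cometric_sym u : (G u)^T = G u.
Proof. by rewrite /G trmx_inv metric_sym. Qed.

Lemma smooth_metric : smooth_mx U g.
Proof. by apply: smooth_mxM => //; exact: smooth_mx_tr. Qed.

Lemma smooth_cometric : smooth_mx U G.
Proof. by apply: smooth_invmx => //; [exact: smooth_metric|exact: metric_unit]. Qed.

Lemma smooth_conn i : smooth_mx U (conn i).
Proof.
have s1 := smooth_mxM U_open (smooth_pdmx i X_smooth) (smooth_mx_tr X_smooth).
exact: (smooth_mxM U_open s1 smooth_cometric).
Qed.

Lemma smooth_shape i : smooth_mx U (shape i).
Proof.
have s1 := smooth_mxM U_open (smooth_pdmx i X_smooth) (smooth_mx_tr N_smooth).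
exact: (smooth_mxN U_open s1).
Qed.

Lemma smooth_sff : smooth_mx U h.
Proof. by move=> i j; under eq_fun do rewrite mxE; exact: smooth_shape. Qed.

Lemma conn_torsion_free i j k u : U u -> conn i u j k = conn j u i k.
Proof.
move=> Uu; have E := X_integrable i j Uu.
have : row j (conn i u) = row i (conn j u) by rewrite !row_mul E.
by move/rowP => /(_ k); rewrite [LHS]mxE [RHS]mxE.
Qed.

Lemma sff_sym u : U u -> (h u)^T = h u.
Proof.
move=> Uu; apply/matrixP => i j.
rewrite [LHS]mxE [LHS]mxE [RHS]mxE [LHS]mxE [RHS]mxE; congr (- _).
have : row i (pdmx j X u *m (N u)^T) = row j (pdmx i X u *m (N u)^T).
  by rewrite !row_mul X_integrable.
by move/rowP => /(_ 0); rewrite [LHS]mxE [RHS]mxE.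
Qed.

(** Both sides have the same products with X and with N. *)
Lemma gauss_formula i u : U u ->
  pdmx i X u = conn i u *m X u - shape i u *m N u.
Proof.
move=> Uu; apply/eqP; rewrite -subr_eq0; apply/eqP.
have NX : N u *m (X u)^T = 0 by rewrite -[LHS]trmxK trmx_mul trmxK X_ortho_N// trmx0.
apply: (frame_complete Uu).
  rewrite mulmxBl mulmxBl -!mulmxA NX mulmx0 subr0 /conn /G -/(g u).
  rewrite mulVmx ?mulmx1 ?subrr//.
  exact: metric_unit.
rewrite mulmxBl mulmxBl -!mulmxA X_ortho_N// N_unit// mulmx0 mulmx1.
by rewrite !mulmx0 sub0r opprK /shape subrr.
Qed.

(** N has constant length, so its derivative is tangential; the tangential part
    comes from differentiating the orthogonality of X and N. *)
Lemma weingarten_formula i u : U u -> pdmx i N u = (shape i u)^T *m G u *m X u.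
Proof.
move=> Uu; apply/eqP; rewrite -subr_eq0; apply/eqP.
have sNt : smooth_mx U (fun v => (N v)^T) by exact: smooth_mx_tr.
apply: (frame_complete Uu).
  have E : pdmx i X u *m (N u)^T + X u *m (pdmx i N u)^T = 0.
    rewrite -pdmx_tr -(pdmxM U_open)//.
    rewrite (eq_on_pdmx U_open i (M' := fun=> 0) X_ortho_N)//.
    by rewrite pdmx_cst.
  rewrite mulmxBl -(mulmxA _ (X u)) -/(g u) /G mulmxKV ?metric_unit//.
  apply: trmx_inj; rewrite trmx0 linearB /= trmx_mul !trmxK.
  by rewrite /shape opprK addrC.
have E : pdmx i N u *m (N u)^T + N u *m (pdmx i N u)^T = 0.
  rewrite -pdmx_tr -(pdmxM U_open)// (eq_on_pdmx U_open i (M' := fun=> 1%:M) N_unit)//.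
  by rewrite pdmx_cst.
rewrite mulmxBl -!mulmxA X_ortho_N// !mulmx0 subr0.
have S : N u *m (pdmx i N u)^T = pdmx i N u *m (N u)^T.
  apply/matrixP => c d; rewrite !ord1 !mxE.
  by apply: eq_bigr => k _; rewrite !mxE mulrC.
apply/matrixP => c d; move/matrixP/(_ c d): E; rewrite S !mxE -mulr2n => /eqP.
by rewrite mulrn_eq0 => /eqP.
Qed.

(** The equations of Gauss and Codazzi, before they are brought into geometric
    form, are the coefficients of X and N in d_b d_i X = d_i d_b X. *)
Lemma frame_flat b i u : U u ->
  (pdmx b (conn i) u + conn i u *m conn b u - shape i u *m (shape b u)^T *m G u
   = pdmx i (conn b) u + conn b u *m conn i u - shape b u *m (shape i u)^T *m G u)
  /\ pdmx b (shape i) u + conn i u *m shape b u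
   = pdmx i (shape b) u + conn b u *m shape i u.
Proof.
have ddX b' i' v : U v -> pdmx b' (pdmx i' X) v =
    (pdmx b' (conn i') v + conn i' v *m conn b' v
       - shape i' v *m (shape b' v)^T *m G v) *m X v
    - (pdmx b' (shape i') v + conn i' v *m shape b' v) *m N v.
  move=> Uv; rewrite (eq_on_pdmx U_open b' (gauss_formula i') Uv).
  have sc := smooth_conn i'; have ss := smooth_shape i'.
  have scX := smooth_mxM U_open sc X_smooth; have ssN := smooth_mxM U_open ss N_smooth.
  rewrite (pdmxD _ scX (smooth_mxN U_open ssN) Uv).
  rewrite (pdmxN _ ssN Uv) (pdmxM U_open _ sc X_smooth Uv).
  rewrite (pdmxM U_open _ ss N_smooth Uv).
  rewrite gauss_formula// weingarten_formula//.
  move: (pdmx _ (conn _) v) (pdmx _ (shape _) v) (conn i' v) (conn b' v)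
    (shape i' v) (shape b' v)^T (shape b' v) (G v) (X v) (N v)
    => dA ds A B s t' t K F n.
  rewrite !mulmxBl !mulmxDl !mulmxBr !mulmxA.
  by rewrite !opprD !addrA [LHS](ACl (1*2*5*4*3)).
move=> Uu; have := pdmxC U_open b i X_smooth Uu; rewrite (ddX b i u Uu) (ddX i b u Uu).
move/eqP; rewrite -subr_eq0 opprB addrA (ACl (1*4*(3*2))) /= -!mulmxBl => /eqP E.
have [/subr0_eq EX /subr0_eq EN] := frame_free Uu E.
by split; [exact: EX|exact: esym EN].
Qed.

Lemma shapeE i : shape i = fun u => col i (h u).
Proof. by apply/funext => u; apply/matrixP => a b; rewrite ord1 !mxE. Qed.

Lemma frame_gauss b i u : U u -> curv conn b i u
  = (col i (h u) *m row b (h u) - col b (h u) *m row i (h u)) *m G u.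
Proof.
move=> Uu; have [E _] := frame_flat b i Uu.
have rowE c : row c (h u) = (shape c u)^T.
  by rewrite shapeE -{1}(sff_sym Uu) tr_col.
have rearrange (x y s z w t : 'M[R]_m) :
    x + y - s = z + w - t -> x - z + y - w = s - t.
  move=> xE; have -> : x = z + w - t + s - y by rewrite -xE subrK addrK.
  by apply/matrixP => c d; rewrite !mxE; ring.
have colE c : col c (h u) = shape c u by rewrite shapeE.
by rewrite !rowE !colE mulmxBl; exact: rearrange E.
Qed.

Lemma frame_codazzi b i u : U u ->
  pdmx b (fun v => col i (h v)) u + conn i u *m col b (h u)
  = pdmx i (fun v => col b (h v)) u + conn b u *m col i (h u).
Proof. by move=> Uu; have [_] := frame_flat b i Uu; rewrite !shapeE. Qed.

(** From the derivative of G g = 1, where d_k g = conn_k g + g conn_k^T. *)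
Lemma cometric_parallel k u : U u ->
  pdmx k G u = - (G u *m conn k u) - (conn k u)^T *m G u.
Proof.
move=> Uu; have sG := smooth_cometric; have sg := smooth_metric.
have gu := metric_unit Uu.
have dg : pdmx k g u = conn k u *m g u + g u *m (conn k u)^T.
  have cg : conn k u *m g u = pdmx k X u *m (X u)^T by rewrite mulmxKV.
  have cgT : g u *m (conn k u)^T = X u *m (pdmx k X u)^T.
    by rewrite -[g u]metric_sym -trmx_mul cg trmx_mul trmxK.
  by rewrite cg cgT -pdmx_tr -(pdmxM U_open _ X_smooth (smooth_mx_tr X_smooth) Uu).
have : pdmx k (fun v => G v *m g v) u = 0.
  rewrite (eq_on_pdmx U_open k (M' := fun=> 1%:M) _ Uu) ?pdmx_cst//.
  by move=> v Uv; exact: mulVmx (metric_unit Uv).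
rewrite (pdmxM U_open _ sG sg Uu) => /eqP; rewrite addr_eq0 => /eqP E.
have -> : pdmx k G u = pdmx k G u *m g u *m G u by rewrite mulmxK.
have gG : g u *m G u = 1%:M by exact: mulmxV.
have Gg : G u *m g u = 1%:M by exact: mulVmx.
rewrite E dg; move: (G u) (g u) (conn k u) gG Gg => K g0 C gG Gg.
rewrite mulNmx mulmxDr mulmxDl opprD !mulmxA Gg mul1mx; congr (- _ - _).
by rewrite -!mulmxA gG mulmx1.
Qed.

Lemma frame_simons i j u : U u ->
  \sum_a \sum_b G u a b * cov2 conn b a h u i j
  = pd i (pd j (mean G h)) u - \sum_k conn i u j k * pd k (mean G h) u
    + mean G h u * sff2 G h u i j - \tr (G u *m sff2 G h u) * h u i j.
Proof.
apply: (structural_simons U_open).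
- exact: smooth_conn.
- exact: smooth_cometric.
- exact: smooth_sff.
- exact: conn_torsion_free.
- exact: sff_sym.
- exact: cometric_parallel.
- exact: frame_gauss.
- exact: frame_codazzi.
Qed.

End AdaptedFrame.

(** * Simons' identity in a chart *)

Section CovariantDerivatives.
Context {R : realType} {m : nat}.
Variable U : set 'rV[R]_m.
Hypothesis U_open : open U.
Variables (g : @tensor2 R m) (conn : 'I_m -> 'rV[R]_m -> 'M[R]_m).
Hypothesis christoffel_conn : forall i j k u, U u ->
  christoffel g k i j u = conn i u j k.
Variables (T : @tensor2 R m) (M : 'rV[R]_m -> 'M[R]_m).
Hypothesis T_M : forall k l, eq_on U (T k l) (fun u => M u k l).
Implicit Types (i j k a b : 'I_m) (u : 'rV[R]_m).

(** With the Christoffel symbols gathered in matrices, the component formulas for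
    covariant derivatives are those for [cov] and [cov2]. *)
Lemma nabla2_cov a i j : eq_on U (nabla2 g T a i j) (fun u => cov conn a M u i j).
Proof.
move=> u Uu; rewrite /nabla2 covE (eq_on_pd U_open a (T_M i j) Uu).
by congr (_ - _ - _); apply: eq_bigr => k _; rewrite christoffel_conn// T_M.
Qed.

Lemma nabla3_cov2 b a i j u : U u ->
  nabla3 g (nabla2 g T) b a i j u = cov2 conn b a M u i j.
Proof.
move=> Uu; rewrite cov2E covE /nabla3 (eq_on_pd U_open b (nabla2_cov a i j) Uu).
rewrite [LHS](ACl (1*3*4*2)) /=.
by congr (_ - _ - _ - _); apply: eq_bigr => k _; rewrite christoffel_conn// nabla2_cov.
Qed.

End CovariantDerivatives.

Section Chart.
Context {R : realType} {m : nat}.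
Variables (E : set 'rV[R]_m.+1) (U : set 'rV[R]_m).
Variables phi N : 'rV[R]_m -> 'rV[R]_m.+1.
Hypothesis chart : boundary_chart E U phi N.
Implicit Types (i j k a b : 'I_m) (u v : 'rV[R]_m).

Definition frame u : 'M[R]_(m, m.+1) := \matrix_(i < m) tangent phi i u.

Local Notation X := frame.
Local Notation g := (first_form phi).
Local Notation A := (second_form phi N).

Let U_open : open U := chart_open chart.

Lemma frameE i c : (fun u => X u i c) = pd i (coord_fun phi c).
Proof. by apply/funext => u; rewrite /frame !mxE. Qed.

Lemma smooth_frame : smooth_mx U X.
Proof. by move=> i c; rewrite frameE; exact/smooth_pd/(chart_smooth chart). Qed.

Lemma smooth_normal : smooth_mx U N.
Proof. by move=> i c; rewrite ord1; exact: (normal_smooth chart c). Qed.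

Lemma dotvE p (x y : 'rV[R]_p) : dotv x y = (x *m y^T) 0 0.
Proof. by rewrite mxE; apply: eq_bigr => c _; rewrite mxE. Qed.

Lemma frame_ortho_normal u : U u -> X u *m (N u)^T = 0.
Proof.
move=> Uu; apply/matrixP => i c; rewrite ord1 [RHS]mxE.
rewrite -(normal_orthogonal chart i Uu) dotvE !mxE.
by apply: eq_bigr => d _; rewrite [X u i d]mxE.
Qed.

Lemma normal_unit_mx u : U u -> N u *m (N u)^T = 1%:M.
Proof.
move=> Uu; apply/matrixP => c d; rewrite !ord1 -dotvE mxE eqxx.
have := normal_unit chart Uu; rewrite /enorm => nN.
have n0 : 0 <= dotv (N u) (N u) by apply: sumr_ge0 => k _; exact: sqr_ge0.
by rewrite -(sqr_sqrtr n0) nN expr1n.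
Qed.

Lemma frame_integrable i j u : U u -> row j (pdmx i X u) = row i (pdmx j X u).
Proof.
move=> Uu; apply/rowP => c; rewrite [LHS]mxE [RHS]mxE [LHS]mxE [RHS]mxE !frameE.
by apply: (pdC U_open) Uu; exact: (chart_smooth chart).
Qed.

Local Notation G := (cometric X).
Local Notation conn := (conn X).
Local Notation h := (sff X N).

Lemma first_formE i j : g i j = fun u => metric X u i j.
Proof.
apply/funext => u; rewrite /first_form dotvE !mxE.
by apply: eq_bigr => c _; rewrite !mxE.
Qed.

Lemma ginvE i j u : ginv g i j u = G u i j.
Proof.
rewrite /ginv /cometric; congr (invmx _ _ _).
by apply/matrixP => k l; rewrite mxE first_formE.
Qed.

(** The two sides differentiate the parametrization in opposite orders, and agree
    by the symmetry of h. *)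
Lemma second_formE i j : eq_on U (A i j) (fun u => h u i j).
Proof.
move=> u Uu; rewrite -(sff_sym N frame_integrable Uu) /second_form dotvE !mxE.
congr (- _); apply: eq_bigr => c _; rewrite !mxE.
by rewrite frameE.
Qed.

(** Koszul's formula: the first derivatives of the metric contain the tangential
    part L of the second derivatives of the parametrization, in the combination
    that the symmetry of L collapses to 2 L. *)
Lemma christoffelE i j k u : U u -> christoffel g k i j u = conn i u j k.
Proof.
move=> Uu; have sX := smooth_frame; have sXt := smooth_mx_tr sX.
have [L LE] : exists L, forall b, L b = pdmx b X u *m (X u)^T by eexists.
have dg b c d : pd b (g c d) u = L b c d + L b d c.
  have -> : pd b (g c d) u = pdmx b (fun v => X v *m (X v)^T) u c d.
    by rewrite first_formE [RHS]mxE.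
  rewrite (pdmxM U_open b sX sXt Uu) pdmx_tr mxE -LE; congr (_ + _).
  have -> : X u *m (pdmx b X u)^T = (L b)^T by rewrite LE trmx_mul trmxK.
  by rewrite mxE.
have sw b c d : L b c d = L c b d.
  have : row c (L b) = row b (L c) by rewrite !LE !row_mul frame_integrable.
  by move/rowP => /(_ d); rewrite [LHS]mxE [RHS]mxE.
have koszul l : pd i (g j l) u + pd j (g i l) u - pd l (g i j) u = 2 * L i j l.
  have sum3 (p q r x y z : R) :
    p = x + y -> q = x + z -> r = y + z -> p + q - r = 2 * x.
    by move=> -> -> ->; ring.
  apply: (sum3 _ _ _ _ (L i l j) (L j l i) (dg i j l)).
    by rewrite dg (sw j i).
  by rewrite dg (sw l i) (sw l j).
rewrite /christoffel /conn -LE [RHS]mxE mulr_sumr; apply: eq_bigr => l _.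
rewrite koszul ginvE -[in LHS](cometric_sym X u) [_^T _ _]mxE.
by move: (G u l k) (L i j l) => x y; field.
Qed.

Lemma mean_curvatureE : eq_on U (mean_curvature phi N) (mean G h).
Proof.
move=> u Uu; rewrite /mean mxtrace_mulE; apply: eq_bigr => i _; apply: eq_bigr => j _.
by rewrite ginvE second_formE// -{1}(sff_sym N frame_integrable Uu) mxE.
Qed.

Lemma second_form_sqE i j :
  eq_on U (second_form_sq phi N i j) (fun u => sff2 G h u i j).
Proof.
move=> u Uu; rewrite /sff2 mulmx3E; apply: eq_bigr => k _; apply: eq_bigr => l _.
by rewrite ginvE !second_formE// mulrA.
Qed.

Lemma second_form_norm2E u : U u -> second_form_norm2 phi N u = \tr (G u *m sff2 G h u).
Proof.
move=> Uu; rewrite mxtrace_mulE; apply: eq_bigr => i _; apply: eq_bigr => j _.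
rewrite ginvE second_form_sqE//.
have sq_sym : (sff2 G h u)^T = sff2 G h u.
  rewrite /sff2 !trmx_mul (cometric_sym X u) (sff_sym N frame_integrable Uu).
  by rewrite mulmxA.
by rewrite -{1}sq_sym mxE.
Qed.

Lemma chart_simons i j u : U u ->
  tensor_laplacian g A i j u =
    covariant_hessian g (mean_curvature phi N) i j u
    + mean_curvature phi N u * second_form_sq phi N i j u
    - second_form_norm2 phi N u * A i j u.
Proof.
move=> Uu; rewrite /tensor_laplacian /covariant_hessian.
rewrite mean_curvatureE// second_form_sqE// second_form_norm2E// second_formE//.
have dH k := eq_on_pd U_open k mean_curvatureE.
rewrite (eq_on_pd U_open i (dH j) Uu).
have -> : \sum_k christoffel g k i j u * pd k (mean_curvature phi N) u
    = \sum_k conn i u j k * pd k (mean G h) u.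
  by apply: eq_bigr => k _; rewrite christoffelE// dH.
rewrite -(frame_simons U_open smooth_frame smooth_normal (chart_immersion chart)
  frame_ortho_normal normal_unit_mx frame_integrable)//.
apply: eq_bigr => a _; apply: eq_bigr => b _.
by rewrite ginvE (nabla3_cov2 U_open christoffelE second_formE).
Qed.

End Chart.

(* The ambient space is R^n with n = m + 1. *)
Theorem theorem1p2 (R : realType) (m : nat) (E : set 'rV[R]_m.+1)
    (x : 'rV[R]_m.+1) (R0 beta C : R)
    (E_smooth : smooth_boundary E)
    (x_bd : boundary E x)
    (R0_gt0 : 0 < R0)
    (beta_ge0 : 0 <= beta) (beta_lt : beta < m.+1%:R + 1)
    (C_gt0 : 0 < C)
    (growth : forall r : R, R0 <= r ->
      (hausdorff_measure m (boundary E `&` eball x r) <= (C * r `^ beta)%:E)%E) :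
  simons_identity_at E x.
Proof. by move=> U phi N u chart Uu _ i j; exact: (chart_simons chart i j Uu). Qed.
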